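(* For all but finitely many positive integers $n$, an $MH(n,11)$ exists if and only if $n$ is even or $n$ is congruent to a square modulo $11$ (the residue $0$ counted as a square).
   Context: For positive integers $n, m$, an $MH(n,m)$ (an $m$-modular Hadamard matrix of size $n$) is an $n \times n$ matrix $H$ with all entries in $\{+1,-1\}$ such that $HH^\top \equiv nI \pmod{m}$ (entrywise), where $I$ is the identity matrix. *)

(* Defs.v *)
From mathcomp Require Import all_boot all_order all_algebra.

Set Implicit Arguments.
Unset Strict Implicit.
Unset Printing Implicit Defensive.

Import GRing.Theory.
Local Open Scope ring_scope.

Definition is_MH (n m : nat) (H : 'M[int]_n) : Prop :=
  (forall i j, H i j = 1 \/ H i j = -1) /\
  (forall i j, ((H *m H^T) i j = (n%:Z *: (1%:M : 'M[int]_n)) i j %[mod m%:Z])%Z).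

Definition MH_exists (n m : nat) : Prop := exists H : 'M[int]_n, is_MH m H.

Definition square_mod (m n : nat) : Prop :=
  exists a : nat, (n = a ^ 2 %[mod m])%N.

Definition for_all_but_finitely_many_pos (P : nat -> Prop) : Prop :=
  exists s : seq nat, forall n : nat, (0 < n)%N -> n \notin s -> P n.

(* Main.v *)
(** Necessity for odd n: det(H)^2 = n^n modulo 11.

    For sufficiency, call E a weighing matrix of weight w if its entries are in
    {0, 1, -1} and E E^T = w I over F_11.  Suppose H is Hadamard modulo 11 of
    size n = 4w and contains a submatrix that agrees with E on the support of E.
    Replace each row and column meeting E by x = 1 mod 11 copies, every entry h
    by the block h J, and h by -h (J - 2I) on the support of E: since x = 1, the
    result is again Hadamard modulo 11.  Its size has grown by (x - 1) times the
    size of E.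

    If w = 4^j, weighing matrices of weight w exist in the coprime sizes 7^j and
    4^j (Kronecker powers).  A large Sylvester matrix contains every sign pattern,
    and its size 2^k can be taken congruent to 4w, so all large n = 4^(j+1) mod 11
    are reached; these are all the nonzero squares.  The all-ones matrix does
    n = 0, and doubling does the even nonsquares. *)

Require Import Defs.
From mathcomp Require Import all_boot all_order all_algebra.
From mathcomp Require Import ring.

Set Implicit Arguments.
Unset Strict Implicit.
Unset Printing Implicit Defensive.

Import GRing.Theory.
Local Open Scope ring_scope.

(** * Hadamard and weighing matrices over a ring; Kronecker products *)

Definition signs (R : comNzRingType) : seq R := [:: 1; -1].

(** Rows and columns have separate types because a blow-up indexes them by different sigma types. *)
Definition hadamard (R : comNzRingType) (n : nat) : Prop :=
  exists (I J : finType) (H : I -> J -> R),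
    [/\ #|I| = n, #|J| = n, forall i j, H i j \in signs R
      & forall i i', \sum_j H i j * H i' j = n%:R *+ (i == i')].

Definition weighing (R : comNzRingType) (w : R) (s : nat) : Prop :=
  exists (I : finType) (E : I -> I -> R),
    [/\ #|I| = s, forall i j, E i j \in 0 :: signs R
      & forall i i', \sum_j E i j * E i' j = w *+ (i == i')].

Lemma signs_mul (R : comNzRingType) (x y : R) :
  x \in signs R -> y \in signs R -> x * y \in signs R.
Proof.
rewrite !inE => /orP[]/eqP-> /orP[]/eqP->;
by rewrite ?mul1r ?mulr1 ?mulN1r ?opprK eqxx ?orbT.
Qed.

Lemma sum_prod_kronecker (R : comNzRingType) (I J I' J' : finType)
    (A : I -> J -> R) (B : I' -> J' -> R) (i k : I * I') :
  \sum_(j : J * J') (A i.1 j.1 * B i.2 j.2) * (A k.1 j.1 * B k.2 j.2)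
  = (\sum_j A i.1 j * A k.1 j) * (\sum_j B i.2 j * B k.2 j).
Proof.
rewrite big_distrlr /= pair_bigA /=.
by apply: eq_bigr => j _; rewrite mulrACA.
Qed.

Lemma hadamard_mul (R : comNzRingType) (n n' : nat) :
  hadamard R n -> hadamard R n' -> hadamard R (n * n').
Proof.
move=> [I [J [A [cI cJ sA gA]]]] [I' [J' [B [cI' cJ' sB gB]]]].
exists (I * I')%type, (J * J')%type, (fun i j => A i.1 j.1 * B i.2 j.2).
split; rewrite ?card_prod ?cI ?cI' ?cJ ?cJ' // => i i'.
  exact: signs_mul.
by rewrite sum_prod_kronecker gA gB mulrnAl mulrnAr -mulrnA natrM
           -pair_eqE /pair_eq /= mulnC mulnb.
Qed.

Lemma weighing_mul (R : comNzRingType) (w w' : R) (s s' : nat) :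
  weighing w s -> weighing w' s' -> weighing (w * w') (s * s').
Proof.
move=> [I [A [cI sA gA]]] [I' [B [cI' sB gB]]].
exists (I * I')%type, (fun i j => A i.1 j.1 * B i.2 j.2).
split; rewrite ?card_prod ?cI ?cI' // => i i'.
  have := sB i.2 i'.2; have := sA i.1 i'.1; rewrite !in_cons.
  case/orP=> [/eqP-> _|sa]; first by rewrite mul0r eqxx.
  case/orP=> [/eqP->|sb]; first by rewrite mulr0 eqxx.
  by rewrite -!in_cons in_cons signs_mul ?orbT.
by rewrite sum_prod_kronecker gA gB mulrnAl mulrnAr -mulrnA -pair_eqE /pair_eq /= mulnC mulnb.
Qed.

Lemma weighing_exp (R : comNzRingType) (w : R) (s j : nat) :
  weighing w s -> weighing (w ^+ j) (s ^ j).
Proof.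
move=> Ws; elim: j => [|j IHj]; last by rewrite exprS expnS; apply: weighing_mul.
exists unit, (fun _ _ => 1); split; rewrite ?card_unit // => i k; first by rewrite !inE eqxx orbT.
case: i k => [] []; by rewrite big_const card_unit /= mulr1 addr0.
Qed.

Lemma weighing2 (R : comNzRingType) : weighing (2%:R : R) 2.
Proof.
exists 'I_2, (fun i j => if (i == 1%R) && (j == 1%R) then -1 else 1).
split; rewrite ?card_ord // => i k; first by case: ifP; rewrite !inE eqxx ?orbT.
rewrite !big_ord_recl big_ord0.
by case: i => [[|[|[]]]] // ?; case: k => [[|[|[]]]] //= ?; rewrite /eq_op /=; ring.
Qed.

(** The circulant with first row -1 at 0, 1 at the squares 1, 2, 4 modulo 7, and 0 elsewhere. As {1,
    2, 4} is a (7,3,1) difference set, a nonzero shift gives one product 1 inside it and one product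
    -1 involving 0. *)
Lemma weighing7 (R : comNzRingType) : weighing (4%:R : R) 7.
Proof.
pose c : seq R := [:: -1; 1; 1; 0; 1; 0; 0].
exists 'I_7, (fun i j : 'I_7 => c`_((j + (7 - i)) %% 7)).
split; rewrite ?card_ord // => i k.
  have: ((k + (7 - i)) %% 7 < size c)%N by rewrite ltn_mod.
  by move/(mem_nth 0); rewrite !inE; do !case/orP; move=> /eqP->; rewrite eqxx ?orbT.
rewrite !big_ord_recl big_ord0.
case: i => [[|[|[|[|[|[|[|[]]]]]]]]] // ?;
case: k => [[|[|[|[|[|[|[|[]]]]]]]]] // ?; rewrite /eq_op /=; ring.
Qed.

(** * Sylvester matrices and blow-ups *)

Definition sylvester (R : comNzRingType) (T : finType) (A B : {set T}) : R :=
  (-1) ^+ #|A :&: B|.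

Lemma sylvester_sign (R : comNzRingType) (T : finType) (A B : {set T}) :
  sylvester R A B \in signs R.
Proof.
by rewrite /sylvester -signr_odd !inE; case: odd; rewrite ?expr1 eqxx ?orbT.
Qed.

Lemma sylvester_gram (R : comNzRingType) (T : finType) (A A' : {set T}) :
  \sum_B sylvester R A B * sylvester R A' B = (2 ^ #|T|)%:R *+ (A == A').
Proof.
have sylvE C B : sylvester R C B = \prod_t (if t \in B then (-1) ^+ (t \in C) else 1).
  rewrite /sylvester -prodr_const big_mkcond /=; apply: eq_bigr => t _.
  by rewrite inE; case: (t \in C); case: (t \in B).
(* The sum is the expansion of a product with one factor 1 + (+-1) for each point. *)
transitivity (\prod_t ((-1) ^+ (t \in A) * (-1) ^+ (t \in A') + 1) : R).
  rewrite bigA_distr; apply: eq_bigr => B _; rewrite !sylvE -big_split /=.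
  by apply: eq_bigr => t _; case: ifP; rewrite ?mulr1.
have [<-|neqA] := eqVneq A A'.
  rewrite mulr1n natrX -prodr_const; apply: eq_bigr => t _.
  by rewrite -expr2 sqrr_sign -natr1.
have /existsP[t neqt]: [exists t, (t \in A) != (t \in A')].
  by apply: contraNT neqA => /existsPn eqA; apply/eqP/setP=> t; apply/eqP/negbNE/eqA.
rewrite (bigD1 t) //=; case: (t \in A) neqt; case: (t \in A') => // _;
  by rewrite ?mulr1 ?mul1r addNr mul0r.
Qed.

(* Row i becomes x i rows and column j becomes y j columns; E is 0 off the
   weighing patterns, and x i > 1 is allowed only on the rows that meet one. *)
Lemma hadamard_blowup (R : comNzRingType) (I J : finType) (H E : I -> J -> R)
    (x : I -> nat) (y : J -> nat) (n : R) :
  (forall i j, H i j \in signs R) ->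
  (forall i i', \sum_j H i j * H i' j = n *+ (i == i')) ->
  (forall i j, E i j = 0 \/ E i j = H i j /\ x i = y j) ->
  (forall i i', i != i' -> \sum_j E i j * E i' j = 0) ->
  (forall i, x i = 1%N \/ 4%:R * (\sum_j E i j * E i j) = n) ->
  (forall j, (y j)%:R = 1 :> R) -> (\sum_i x i)%:R = n ->
  (\sum_i x i = \sum_j y j)%N ->
  hadamard R (\sum_i x i).
Proof.
move=> sH gH EH gE wE y1 xn xy.
(* This is [h J] where [E] vanishes and [-h (J - 2I)] where [E] agrees with [H]; there [x i = y j]
   makes the block square. *)
pose G i (a : nat) j (b : nat) := H i j - 2%:R * E i j + 2%:R * E i j *+ (a == b).
exists {i : I & 'I_(x i)}, {j : J & 'I_(y j)},
  (fun r c => G (tag r) (tagged r : 'I_(x (tag r))) (tag c) (tagged c : 'I_(y (tag c)))).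
split.
- by rewrite card_tagged sumnE big_map big_enum /=; apply: eq_bigr => i _; rewrite card_ord.
- by rewrite xy card_tagged sumnE big_map big_enum /=; apply: eq_bigr => j _; rewrite card_ord.
- move=> [i a] [j b] /=; rewrite /G.
  have [->|[-> _]] := EH i j; first by rewrite !mulr0 subr0 mul0rn addr0.
  have: - H i j \in signs R.
    by rewrite -mulN1r signs_mul // !inE eqxx orbT.
  case: eqP => _; first by rewrite subrK.
  by rewrite mulr0n addr0 mulr2n mulrDl !mul1r opprD addNKr.
move=> [i a] [i' a'] /=; rewrite xn.
transitivity (\sum_j \sum_(b < y j) G i a j b * G i' a' j b).
  by rewrite sig_big_dep.
have one k (e : nat) j : E k j = 0 \/ (e < y j)%N ->
    \sum_(b < y j) E k j *+ (e == b :> nat) = E k j.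
  case=> [->|lt_e]; first by rewrite big1 // => b _; rewrite mul0rn.
  rewrite (bigD1 (Ordinal lt_e)) //= eqxx big1 ?addr0 // => b.
  by rewrite -val_eqE /= eq_sym => /negbTE->.
have cst j (c : R) : \sum_(b < y j) c = c.
  by rewrite sumr_const card_ord -mulr_natr y1 mulr1.
have ltE k (e : 'I_(x k)) j : E k j = 0 \/ (e < y j)%N.
  by have [|[_ <-]] := EH k j; [left | right; exact: ltn_ord].
(* As [y j] is 1 in [R], the mixed products of [H] and [E] cancel in each block. *)
transitivity (\sum_j (H i j * H i' j + 4%:R * (E i j * E i' j) *+ (a == a' :> nat)
                      - 4%:R * (E i j * E i' j))).
  apply: eq_bigr => j _.
  transitivity (\sum_(b < y j) ((H i j - 2%:R * E i j) * (H i' j - 2%:R * E i' j)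
     + (H i j - 2%:R * E i j) * 2%:R * (E i' j *+ (a' == b :> nat))
     + (H i' j - 2%:R * E i' j) * 2%:R * (E i j *+ (a == b :> nat))
     + 4%:R * E i j *+ (a == a' :> nat) * (E i' j *+ (a' == b :> nat)))).
    apply: eq_bigr => b _; rewrite /G.
    have [Eab|ab] := eqVneq (a : nat) b; have [Ea'b|a'b] := eqVneq (a' : nat) b.
    - by rewrite Eab Ea'b eqxx !mulr1n; ring.
    - by rewrite !mulr1n !mulr0n; ring.
    - by rewrite Ea'b (negbTE ab) !mulr1n !mulr0n; ring.
    - by rewrite !mulr0n; ring.
  rewrite !big_split /= -!mulr_sumr !one ?cst //; try exact: ltE.
  by case: eqP => _; rewrite ?mulr1n ?mulr0n; ring.
rewrite sumrB big_split /= gH sumrMnl -!mulr_sumr.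
have [eqi|neqi] := eqVneq i i'; last first.
  rewrite gE // mulr0 mul0rn addr0 subr0; case: eqP => // /(congr1 tag) /= eqi.
  by rewrite eqi eqxx in neqi.
case: i' / eqi a' => a'; rewrite eq_Tagged /= mulr1n.
have -> : (a == a' :> nat) = (a == a') by [].
have [_|neqa] := eqVneq a a'; first by rewrite !mulr1n addrK.
(* Distinct copies of row [i] have product [n] minus 4 times the weight of row [i] of [E], which is
   zero; if [x i = 1] there are no distinct copies. *)
have [xi|->] := wE i; last by rewrite mulr0n addr0 subrr.
by case/eqP: neqa; move: (x i) xi a a' => _ -> a a'; rewrite !ord1.
Qed.

Lemma sylvester_pattern (S : finType) (e : nat) (F : S -> S -> bool) :
  exists (T : finType) (f g : S -> {set T}),
    [/\ #|T| = (#|S|.*2 + e)%N, injective f, injective g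
      & forall (R : comNzRingType) i j, sylvester R (f i) (g j) = (-1) ^+ F i j].
Proof.
(* The first copy of S carries F, the second only makes g injective, and 'I_e
   adjusts the size. *)
pose T : finType := ((S + S) + 'I_e)%type.
pose g j : {set T} := [set t | match t with
  inl (inl i) => F i j | inl (inr k) => k == j | inr _ => false end].
exists T, (fun i => [set inl (inl i)]), g; split.
- by rewrite !card_sum card_ord addnn.
- by move=> i i' /set1_inj [].
- by move=> j j' /setP/(_ (inl (inr j))); rewrite !inE eqxx => /esym/eqP.
(* The singleton [f i] meets [g j] in one point or none, according to [F i j]. *)
move=> R i j; rewrite /sylvester; congr (_ ^+ _).
case: (boolP (F i j)) => Fij.
  by rewrite (setIidPl _) ?cards1 // sub1set inE.
by apply: eq_card0 => t; rewrite !inE; case: eqP => // ->; apply/negbTE.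
Qed.

Lemma coprime_combination (a b n : nat) : coprime a b -> (a * b <= n)%N ->
  exists u v, n = (u * a + v * b)%N.
Proof.
move=> cab; case: a b cab => [|a] [|b] cab.
- by [].
- by rewrite /coprime gcd0n in cab; move/eqP: cab => [->] _; exists 0%N, n; rewrite muln1.
- by rewrite /coprime gcdn0 in cab; move/eqP: cab => [->] _; exists n, 0%N; rewrite muln1 addn0.
(* [m] is 0 modulo [a.+1], [n] modulo [b.+1], and below their product, so [n - m] is a natural
   multiple of [b.+1]. *)
move=> le_n; set m := (chinese a.+1 b.+1 0 n %% (a.+1 * b.+1))%N.
have lem : (m <= n)%N by apply: leq_trans (ltnW _) le_n; rewrite ltn_mod.
have am : (a.+1 %| m)%N.
  by rewrite /dvdn modn_dvdm ?dvdn_mulr // chinese_modl // mod0n.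
have bm : (b.+1 %| n - m)%N.
  by rewrite -eqn_mod_dvd // modn_dvdm ?dvdn_mull // chinese_modr.
by exists (m %/ a.+1)%N, ((n - m) %/ b.+1)%N; rewrite !divnK // subnKC.
Qed.

(** Repeating the rows and columns of the first pattern 1 + c u times and those of the second 1 + c
    v times enlarges a Sylvester matrix of order 2^k; the bound on [k] leaves room for both
    patterns. *)
Lemma hadamard_of_weighing (R : comNzRingType) (c k s s' : nat) (w : R) (u v : nat) :
  c%:R = 0 :> R -> weighing w s -> weighing w s' ->
  ((s + s').*2 <= k)%N -> (2 ^ k)%:R = 4%:R * w ->
  hadamard R (2 ^ k + c * (u * s + v * s')).
Proof.
move=> c0 [I [D [cI sD gD]]] [I' [D' [cI' sD' gD']]] le_k kw.
pose S : finType := (I + I')%type.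
(* Block diagonal: no support entry joins the two patterns, so [u] and [v] may differ. *)
pose E0 (i j : S) : R := match i, j with
  inl i, inl j => D i j | inr i, inr j => D' i j | _, _ => 0 end.
have gE0 i i' : \sum_j E0 i j * E0 i' j = w *+ (i == i').
  rewrite big_sumType /=; case: i i' => i [] i' /=;
    rewrite ?gD ?gD' ?[X in X + _]big1 ?[X in _ + X]big1 ?addr0 ?add0r //;
    by move=> *; rewrite ?mul0r ?mulr0.
pose z (i : S) := if i is inl _ then u else v.
have cS : #|S| = (s + s')%N by rewrite card_sum cI cI'.
(* Zeros of [E0] get the sign 1; agreement matters only on the support. *)
have [T [f [g [cT injf injg syl]]]] :=
  sylvester_pattern (k - #|S|.*2) (fun i j => E0 i j == -1).
have {}cT : #|T| = k by rewrite cT subnKC // cS.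
(* Extension of [E0] by zero: injectivity leaves at most one term in the sums. *)
pose E (A B : {set T}) := \sum_(i | f i == A) \sum_(j | g j == B) E0 i j.
have Efg i j : E (f i) (g j) = E0 i j.
  rewrite /E (big_pred1 i) => [|i']; last by rewrite /= (inj_eq injf).
  by rewrite (big_pred1 j) => [|j'] //=; rewrite (inj_eq injg).
have Ef A B : (forall i, f i != A) -> E A B = 0.
  by move=> nA; apply: big_pred0 => i; apply/negbTE.
have Eg A B : (forall j, g j != B) -> E A B = 0.
  by move=> nB; apply: big1 => i _; apply: big_pred0 => j; apply/negbTE.
(* Off the image of [h] the sum is empty and the multiplicity is 1. *)
pose x (h : S -> {set T}) A := (1 + c * \sum_(i | h i == A) z i)%N.
have xE h i : injective h -> x h (h i) = (1 + c * z i)%N.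
  by move=> injh; rewrite /x (big_pred1 i) // => i'; rewrite /= (inj_eq injh).
have x1 h A : (x h A)%:R = 1 :> R by rewrite natrD natrM c0 mul0r addr0.
have sumx h : (\sum_A x h A = 2 ^ k + c * (u * s + v * s'))%N.
  rewrite big_split /= sum1_card -cardsT -powersetT card_powerset cardsT cT -big_distrr /=.
  have <-: (\sum_i z i = \sum_A \sum_(i | h i == A) z i)%N.
    exact: (partition_big h xpredT).
  rewrite big_sumType /= !sum_nat_const cI cI'.
  by rewrite mulnC [(s' * v)%N]mulnC [(s * u)%N]mulnC mulnC.
have gE i i' : \sum_B E (f i) B * E (f i') B = w *+ (i == i').
  rewrite -gE0 (partition_big g xpredT) //=; apply: eq_bigr => B _.
  rewrite [E (f i) B]/E (big_pred1 i) => [|k']; last by rewrite /= (inj_eq injf).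
  by rewrite big_distrl; apply: eq_bigr => j /eqP <- /=; rewrite Efg.
have fP (h : S -> {set T}) A : (exists i, h i = A) \/ forall i, h i != A.
  case: (pickP (fun i => h i == A)) => [i /eqP <-|nA]; first by left; exists i.
  by right=> i; rewrite nA.
rewrite -(sumx f); apply: (@hadamard_blowup _ _ _ (sylvester R (T := T)) E _ (x g) (4%:R * w)).
- by move=> A B; apply: sylvester_sign.
- by move=> A B; rewrite sylvester_gram cT kw.
- move=> A B; have [[i <-]|/Ef->] := fP f A; last by left.
  have [[j <-]|/Eg->] := fP g B; last by left.
  rewrite Efg syl !xE //.
  have: E0 i j = 0 \/ E0 i j \in signs R /\ z i = z j.
    case: i j => i [] j /=; try by [left].
      by have := sD i j; rewrite in_cons => /orP[/eqP|]; [left | right].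
    by have := sD' i j; rewrite in_cons => /orP[/eqP|]; [left | right].
  case=> [|[sE <-]]; [by left | right; split=> //].
  by case: eqP => [-> //|nE]; move: sE; rewrite !inE => /orP[] /eqP.
- move=> A A'; have [[i <-]|/Ef A0] := fP f A; last first.
    by move=> _; apply: big1 => B _; rewrite A0 mul0r.
  have [[i' <-]|/Ef A0] := fP f A'; last first.
    by move=> _; apply: big1 => B _; rewrite A0 mulr0.
  by rewrite gE (inj_eq injf) => /negbTE->.
- move=> A; have [[i <-]|nA] := fP f A; first by right; rewrite gE eqxx.
  left; rewrite /x big_pred0 ?muln0 // => i; exact/negbTE.
- exact: x1.
- by rewrite sumx natrD natrM c0 mul0r addr0 kw.
- by rewrite !sumx.
Qed.

(** * Passage to the prime field, and necessity for odd size *)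

Lemma eq_Fp_int (p : nat) (a b : int) :
  prime p -> (a = b %[mod p])%Z <-> a%:~R = b%:~R :> 'F_p.
Proof.
move=> p_pr; split=> [/eqP | /eqP eqab].
  by rewrite eqz_mod_dvd (dvdz_pcharf (pchar_Fp p_pr)) rmorphB subr_eq0 => /eqP.
by apply/eqP; rewrite eqz_mod_dvd (dvdz_pcharf (pchar_Fp p_pr)) rmorphB subr_eq0.
Qed.

Lemma eq_Fp_nat (p a b : nat) :
  prime p -> (a = b %[mod p])%N <-> a%:R = b%:R :> 'F_p.
Proof.
move=> p_pr; split=> [eqab | /(congr1 val)]; last by rewrite /= !val_Fp_nat.
by apply: val_inj; rewrite /= !val_Fp_nat.
Qed.

Lemma hadamard_MH (p n : nat) : prime p -> hadamard 'F_p n -> MH_exists n p.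
Proof.
move=> p_pr [I [J [H [cI cJ sH gH]]]].
pose r (i : 'I_n) : I := enum_val (cast_ord (esym cI) i).
pose c (j : 'I_n) : J := enum_val (cast_ord (esym cJ) j).
exists (\matrix_(i, j) if H (r i) (c j) == 1 then 1 else -1); split=> i i'.
  by rewrite mxE; case: ifP; [left | right].
have entry k j : ((if H (r k) (c j) == 1 then 1 else -1) : int)%:~R = H (r k) (c j).
  have := sH (r k) (c j); rewrite !inE.
  by case: eqP => [-> _|_ /= /eqP->]; rewrite ?rmorphN rmorph1.
apply/(eq_Fp_int _ _ p_pr); rewrite !mxE rmorphM rmorph_sum /= !rmorph_nat.
under eq_bigr => j _ do rewrite !mxE rmorphM /= !entry.
have <-: \sum_j H (r i) j * H (r i') j = (n%:R * (i == i')%:R : 'F_p).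
  by rewrite gH mulr_natr (inj_eq enum_val_inj) (inj_eq (@cast_ord_inj _ _ _)).
rewrite (reindex c) //; apply: onW_bij.
exists (fun j => cast_ord cJ (enum_rank j)) => j.
  by rewrite /c enum_valK cast_ordKV.
by rewrite /c cast_ordK enum_rankK.
Qed.

Lemma MH_odd_square (p n : nat) :
  prime p -> MH_exists n p -> odd n -> square_mod p n.
Proof.
move=> p_pr [H [_ gH]] odd_n; pose M := map_mx (intr : int -> 'F_p) H.
have gM : M *m M^T = n%:R%:M.
  rewrite /M map_trmx -map_mxM; apply/matrixP => i j; rewrite [LHS]mxE /=.
  have /(eq_Fp_int _ _ p_pr) -> := gH i j.
  by rewrite !mxE rmorphM /= !rmorph_nat mulr_natr.
have det_sq : \det M ^+ 2 = n%:R ^+ n.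
  by rewrite expr2 -{2}det_tr -det_mulmx gM det_scalar.
suff [x x2]: exists x : 'F_p, n%:R = x ^+ 2.
  by exists x; apply/(eq_Fp_nat _ _ p_pr); rewrite natrX natr_Zp.
have [n0|nz] := eqVneq (n%:R : 'F_p) 0; first by exists 0; rewrite n0 expr0n.
(* For odd n, n^n is n times the square of n^((n-1)/2), so dividing det^2 = n^n by that square
   leaves n. *)
exists (\det M / n%:R ^+ n./2).
have nn : n%:R ^+ n = n%:R * (n%:R ^+ n./2) ^+ 2 :> 'F_p.
  by rewrite -exprM -exprS muln2; congr (_ ^+ _); rewrite -[LHS]odd_double_half odd_n.
by rewrite expr_div_n det_sq nn mulfK // !expf_neq0.
Qed.

(** * Sufficiency modulo 11 *)

Lemma hadamard_pow4 (j : nat) : exists N, forall n, (N <= n)%N ->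
  (n = 4 ^ j.+1 %[mod 11])%N -> hadamard 'F_11 n.
Proof.
have W7 := weighing_exp j (weighing7 'F_11).
have W4 := weighing_exp j (weighing_mul (weighing2 'F_11) (weighing2 'F_11)).
rewrite -natrM in W4.
(* Since 2^10 = 1 modulo 11, the term [10 * s] makes room for the patterns while 2^k stays congruent
   to 4^(j+1). *)
pose s := (7 ^ j + (2 * 2) ^ j)%N; pose k := (10 * s + 2 * j.+1)%N.
have le_k : (s.*2 <= k)%N.
  by rewrite -mul2n; apply: leq_trans (leq_addr _ _); rewrite leq_mul2r orbT.
have kw : (2 ^ k)%:R = 4%:R * 4%:R ^+ j :> 'F_11.
  have e10 : 2%:R ^+ 10 = 1 :> 'F_11 by apply/eqP; rewrite -natrX.
  by rewrite -exprS natrX exprD exprM e10 expr1n mul1r exprM -natrX.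
(* Beyond this bound (n - 2^k) / 11 is at least the product of the two coprime sizes, hence a
   combination of them. *)
exists (2 ^ k + 11 * (7 ^ j * (2 * 2) ^ j))%N => n le_n n4.
have le2 : (2 ^ k <= n)%N by rewrite (leq_trans _ le_n) ?leq_addr.
have /dvdnP[q nq]: (11 %| n - 2 ^ k)%N.
  rewrite -eqn_mod_dvd //; apply/eqP; rewrite n4; apply/eq_Fp_nat => //.
  by rewrite kw -exprS natrX.
have [||u [v quv]] := @coprime_combination (7 ^ j) ((2 * 2) ^ j) q.
- by rewrite coprimeXl // coprimeXr.
- by rewrite -(leq_pmul2l (isT : 0 < 11)%N) [X in (_ <= X)%N]mulnC -nq leq_subRL.
have -> : n = (2 ^ k + 11 * (u * 7 ^ j + v * (2 * 2) ^ j))%N.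
  by rewrite -quv mulnC -nq subnKC.
apply: (@hadamard_of_weighing _ _ _ _ _ (4%:R ^+ j)) => //.
by apply/eqP.
Qed.

(** 4 has order 5 modulo 11, so its powers exhaust the five nonzero squares. *)
Lemma square_mod11 (n : nat) : square_mod 11 n ->
  (11 %| n)%N \/ exists2 j, (j < 5)%N & (n = 4 ^ j.+1 %[mod 11])%N.
Proof.
case=> a na; have {na} : (n = (a %% 11) ^ 2 %[mod 11])%N by rewrite modnXm.
have /allP/(_ (a %% 11)%N) : all (fun b => (b ^ 2 %% 11 == 0)%N ||
   has (fun j => b ^ 2 %% 11 == 4 ^ j.+1 %% 11)%N (iota 0 5)) (iota 0 11) by [].
rewrite mem_iota ltn_mod => /(_ isT)/orP[/eqP-> /eqP|/hasP[j]]; first by left.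
by rewrite mem_iota => lt_j /eqP-> nj; right; exists j.
Qed.

Lemma hadamard_square_mod11 : exists N, forall n, (N <= n)%N ->
  square_mod 11 n -> hadamard 'F_11 n.
Proof.
have /(_ 5%N)[N N_P] m : exists N, forall j, (j < m)%N -> forall n, (N <= n)%N ->
    (n = 4 ^ j.+1 %[mod 11])%N -> hadamard 'F_11 n.
  elim: m => [|m [N IH]]; first by exists 0%N.
  have [N' N'_P] := hadamard_pow4 m; exists (maxn N N') => j; rewrite ltnS leq_eqVlt.
  case/predU1P=> [->|lt_j] n; rewrite geq_max => /andP[leN leN']; first exact: N'_P.
  exact: IH.
exists N => n leN /square_mod11[|[j lt_j nj]]; last exact: N_P nj.
rewrite (dvdn_pcharf (pchar_Fp (isT : prime 11))) => /eqP n0.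
(* All Gram entries of the all-ones matrix equal n, which is 0 here. *)
exists 'I_n, 'I_n, (fun _ _ => 1); split; rewrite ?card_ord // => i i'.
by rewrite n0 mul0rn mulr1 sumr_const card_ord.
Qed.

Lemma hadamard2 (R : comNzRingType) : hadamard R 2.
Proof.
exists bool, bool, (fun i j => if i && j then -1 else 1).
split; rewrite ?card_bool // => i i'; first by case: ifP; rewrite !inE eqxx ?orbT.
by rewrite big_bool; case: i i' => [] [] /=; ring.
Qed.

(** 2 is a nonsquare modulo 11, so doubling turns a nonsquare into a square. *)
Lemma square_mod11_half (m : nat) : square_mod 11 m \/ square_mod 11 (2 * m).
Proof.
pose Q b := has (fun a => b %% 11 == a ^ 2 %% 11)%N (iota 0 11).
have QP b : Q b -> square_mod 11 b by case/hasP=> a _ /eqP; exists a.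
have Qmod b : Q (b %% 11)%N = Q b by rewrite /Q modn_mod.
have /allP/(_ (m %% 11)%N) : all (fun b => Q b || Q (2 * b)%N) (iota 0 11) by [].
rewrite mem_iota ltn_mod => /(_ isT)/orP[]; first by rewrite Qmod => /QP; left.
by rewrite -Qmod modnMmr Qmod => /QP; right.
Qed.

Local Close Scope ring_scope.

Theorem corollary5p5 :
  for_all_but_finitely_many_pos
    (fun n : nat => MH_exists n 11 <-> (2 %| n \/ square_mod 11 n)).
Proof.
have [N N_P] := hadamard_square_mod11.
(* The factor 2 keeps the half of an even n at least [N]. *)
exists (iota 0 (2 * N)) => n _; rewrite mem_iota add0n -leqNgt /= => le_n.
split=> [mh | n_ok].
  rewrite dvdn2; case: (boolP (odd n)) => odd_n; last by left.
  by right; apply: MH_odd_square mh odd_n.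
apply: hadamard_MH => //.
have le_N : N <= n by apply: leq_trans le_n; rewrite leq_pmull.
case: n_ok => [/dvdnP[m n2m]|]; last exact: N_P.
move: le_n le_N; rewrite n2m (mulnC m) leq_pmul2l // => le_m le_N.
(* Either a matrix of size [m] exists and is doubled, or [2 * m] is itself a square. *)
have [sq|sq] := square_mod11_half m; last exact: N_P.
exact/hadamard_mul/N_P/sq/le_m/hadamard2.
Qed.
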